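(* Let $G$ be a directed graph with vertex set $\{1,\ldots,n\}$ and adjacency matrix $A$. The MAS problem for $G$ is equivalent to the problem $$\|X-A\|\ \to\ \min\quad\text{subject to}\quad X\in\mathbb{R}^{n\times n},\ X\ge 0,\ \rho(X)=0, \qquad (P)$$ where $\|\cdot\|$ is the Frobenius norm; that is, the adjacency matrix of every solution of the MAS problem for $G$ is a solution of (P), and, conversely, every solution $X$ of (P) is a Boolean matrix whose graph solves the MAS problem for $G$.
   Context: A matrix is Boolean if all its entries are $0$ or $1$. The adjacency matrix $A$ of a directed graph on $\{1,\ldots,n\}$ is the Boolean $n\times n$ matrix with $A_{ji}=1$ if there is an edge from $i$ to $j$, and $A_{ji}=0$ otherwise. The graph of a non-negative $n\times n$ matrix $X$ is the directed graph on $\{1,\ldots,n\}$ with an edge from $i$ to $j$ if and only if $X_{ji}>0$. The inequality $X\ge 0$ is entrywise; $\rho(X)$ is the spectral radius, i.e. the largest modulus of the eigenvalues of $X$; the Frobenius norm is $\|X\|=\bigl(\sum_{i,j}|X_{ij}|^2\bigr)^{1/2}$. MAS (Maximal Acyclic Subgraph) problem for a directed graph $G=(\mathcal V,\mathcal E)$: find a graph $\widehat G=(\mathcal V,\widehat{\mathcal E})$ with $\widehat{\mathcal E}\subset\mathcal E$ such that $\widehat G$ has no (directed) cycles and $|\widehat{\mathcal E}|$ is the largest possible. A loop counts as a cycle. *)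

(* Defs.v *)
From HB Require Import structures.
From mathcomp Require Import all_boot all_order all_algebra.
From mathcomp Require Import complex.
From mathcomp Require Import all_classical reals.

Set Implicit Arguments.
Unset Strict Implicit.
Unset Printing Implicit Defensive.

Import Order.TTheory GRing.Theory Num.Theory.
Local Open Scope ring_scope.

(* A directed graph on {0, ..., n-1} is its edge set; (i, j) is the edge from
   i to j, and loops (i, i) are allowed. *)
Definition digraph (n : nat) := {set 'I_n * 'I_n}.

(* Mind the transposition: the edge from i to j is stored in row j, column i. *)
Definition adjmx (R : realType) (n : nat) (G : digraph n) : 'M[R]_n :=
  \matrix_(j, i) (if (i, j) \in G then 1 else 0).

Definition graph_of (R : realType) (n : nat) (X : 'M[R]_n) : digraph n :=
  [set e | 0 < X e.2 e.1].

(* A directed cycle is a nonempty sequence of distinct vertices whose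
   consecutive members (and last and first) are joined by edges; [:: i] is a
   cycle exactly when (i, i) is a loop. *)
Definition acyclic (n : nat) (G : digraph n) : Prop :=
  forall s : seq 'I_n, s != [::] -> ~ ucycle [rel i j | (i, j) \in G] s.

Definition solves_MAS (n : nat) (G H : digraph n) : Prop :=
  [/\ H \subset G, acyclic H
    & forall K : digraph n,
        K \subset G -> acyclic K -> (#|K| <= #|H|)%N].

Definition boolean_mx (R : realType) (m n : nat) (X : 'M[R]_(m, n)) : Prop :=
  forall i j, X i j = 0 \/ X i j = 1.

Definition frobenius (R : realType) (m n : nat) (X : 'M[R]_(m, n)) : R :=
  Num.sqrt (\sum_i \sum_j `|X i j| ^+ 2).

Definition is_eigenvalue (R : realType) (n : nat) (X : 'M[R]_n)
    (l : R[i]) : Prop :=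
  eigenvalue (map_mx (real_complex R) X) l.

(* The supremum is a maximum when n > 0, see spectral_radius_max; for n = 0
   there is no eigenvalue and the value is sup set0 = 0. *)
Definition spectral_radius (R : realType) (n : nat) (X : 'M[R]_n) : R :=
  sup [set r : R | exists2 l : R[i], is_eigenvalue X l & r = Normc.normc l]%classic.

Lemma spectral_radius_max (R : realType) (n : nat) (X : 'M[R]_n) :
  (0 < n)%N ->
  (exists2 l, is_eigenvalue X l & Normc.normc l = spectral_radius X) /\
  (forall l, is_eigenvalue X l -> Normc.normc l <= spectral_radius X).
Proof.
move=> n0; case: n X n0 => // n X _.
pose p := char_poly (map_mx (real_complex R) X).
have [s ps] := closed_field_poly_normal p.
have monp : lead_coef p = 1 by apply/monicP/char_poly_monic.
have eigE l : is_eigenvalue X l <-> l \in s.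
  rewrite /is_eigenvalue eigenvalue_root_char -/p ps monp scale1r.
  by rewrite root_prod_XsubC.
have [a sa] : exists a, a \in s.
  have : size p = n.+2 by rewrite size_char_poly.
  rewrite ps monp scale1r size_prod_XsubC; case: (s) => // a t _.
  by exists a; rewrite mem_head.
have [m sm maxm] : exists2 m, m \in s &
    forall l, l \in s -> Normc.normc l <= Normc.normc m.
  elim: {ps eigE} s a sa => // b s IH a _.
  case: s IH => [_|c s IH].
    by exists b; rewrite ?mem_head // => l; rewrite inE => /eqP ->.
  have [m sm maxm] := IH c (mem_head _ _).
  have [bm|mb] := leP (Normc.normc b) (Normc.normc m).
    exists m; first by rewrite inE sm orbT.
    by move=> l; rewrite inE => /predU1P[-> //|/maxm].
  exists b; first by rewrite mem_head.
  move=> l; rewrite inE => /predU1P[-> //|/maxm lm].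
  exact: le_trans lm (ltW mb).
suff -> : spectral_radius X = Normc.normc m.
  by split=> [|l /eigE/maxm //]; exists m => //; apply/eigE.
apply/eqP; rewrite eq_le; apply/andP; split.
  apply: ge_sup; first by exists (Normc.normc m), m => //; apply/eigE.
  by move=> _ [l /eigE sl ->]; exact: maxm.
apply: ub_le_sup; last by exists m => //; apply/eigE.
by exists (Normc.normc m) => _ [l /eigE sl ->]; exact: maxm.
Qed.

Definition P_feasible (R : realType) (n : nat) (X : 'M[R]_n) : Prop :=
  (forall i j, 0 <= X i j) /\ spectral_radius X = 0.

Definition solves_P (R : realType) (n : nat) (A X : 'M[R]_n) : Prop :=
  P_feasible X /\
  forall Y : 'M[R]_n, P_feasible Y -> frobenius (X - A) <= frobenius (Y - A).

(* Main.v *)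
Require Import Defs.
From mathcomp Require Import boolp classical_sets complex.
From mathcomp Require Import all_boot all_order all_algebra.
From mathcomp Require Import reals.

(** The bridge between the two problems is that a nonnegative matrix [X] has
    spectral radius 0 exactly when its graph is acyclic
    ([spectral_radius_eq0_acyclic]).  Acyclicity is used in the form: every
    nonempty set [S] of vertices has a vertex without successor in [S]
    ([acyclicP]).  If some nonempty [S] lacks such a vertex, then the entries
    over [S] of the row vectors [1 *m X ^+ k] stay positive for all [k], so
    [X] is not nilpotent, whereas a matrix whose only eigenvalue is 0 is
    nilpotent by Cayley-Hamilton.  Conversely, the support of an eigenvector
    for a nonzero eigenvalue is a nonempty set in which every vertex has a
    successor.

    The feasible points of (P) are thus the nonnegative matrices with acyclic
    graph, and the distance of such an [X] to the adjacency matrix of [G] can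
    be read entry by entry: an edge of [G] missing from the graph of [X] costs
    exactly 1, every other entry costs at least 0.  Hence the squared distance
    is at least the number of missing edges, with equality only for the
    adjacency matrix of the common edges of [G] and the graph of [X]
    ([leif_frobenius_sub_adjmx]).  These common edges form an acyclic subgraph
    of [G], so minimizing the distance amounts to minimizing the number of
    edges removed from [G] to obtain an acyclic subgraph. *)

Set Implicit Arguments.
Unset Strict Implicit.
Unset Printing Implicit Defensive.

Import Order.TTheory GRing.Theory Num.Theory.
Local Open Scope ring_scope.

(** If every vertex of [S] has a successor in [S], following successors from any
    vertex must eventually repeat, which closes a cycle; conversely the vertices
    of a cycle form a set in which every vertex has a successor. *)
Lemma acyclicP (n : nat) (H : digraph n) :
  acyclic H <->
  forall S : {set 'I_n}, S != set0 ->
    exists2 i, i \in S & forall j, j \in S -> (i, j) \notin H.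
Proof.
split=> [acH S S0|sink s s0 /andP[cycs _]]; last first.
  case: s s0 cycs => // x s _ cycs.
  have [|i] := sink [set y in x :: s].
    by apply/set0Pn; exists x; rewrite inE mem_head.
  rewrite inE => si /(_ (next (x :: s) i)).
  by rewrite inE mem_next si => /(_ isT)/negP; apply; exact: (next_cycle cycs si).
apply: contrapT => nosink.
have succ i : i \in S -> exists2 j, j \in S & (i, j) \in H.
  move=> Si; apply: contrapT => nj; apply: nosink; exists i => // j Sj.
  by apply/negP => Hij; apply: nj; exists j.
pose f i := odflt i [pick j in S | (i, j) \in H].
have fP i : i \in S -> (f i \in S) && ((i, f i) \in H).
  move=> Si; rewrite /f; case: pickP => //= nj.
  by have [j Sj Hij] := succ i Si; move: (nj j); rewrite Sj Hij.
have iterS k x : x \in S -> iter k f x \in S.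
  by move=> Sx; elim: k => //= k /fP/andP[].
have /set0Pn[x Sx] := S0.
(* The orbit of [x] under [f] loops back at some iterate [y], so [y] is
   reachable from [f y]; a path without repetition is then extracted. *)
have /trajectP[k klt ek] := looping_order f x.
set y := iter k f x in ek; have Sy : y \in S by exact: iterS.
have /connectP[p] : connect [rel i j | (i, j) \in H] (f y) y.
  have {2}-> : y = iter (fingraph.order f x - k.+1) f (f y).
    by rewrite -[LHS]ek -iterSr -subSn // subSS -iterD subnK // ltnW.
  elim: (_ - _)%N => //= m IH; apply: connect_trans IH _.
  by apply: connect1; case/andP: (fP _ (iterS m _ (iterS 1%N _ Sy))).
case/shortenP => q pq uq _ yq.
apply: (acH (f y :: q)) => //; rewrite /ucycle uq andbT /= rcons_path pq -yq /=.
by case/andP: (fP _ Sy).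
Qed.

Lemma acyclicS (n : nat) (H K : digraph n) :
  H \subset K -> acyclic K -> acyclic H.
Proof.
move=> /subsetP sHK acK s s0 /andP[cs us]; apply: (acK s s0).
by rewrite /ucycle us andbT; apply: sub_cycle cs => i j /=; exact: sHK.
Qed.

Lemma spectral_radius_eq0 (R : realType) (n : nat) (X : 'M[R]_n) :
  spectral_radius X = 0 <-> (forall l, is_eigenvalue X l -> l = 0).
Proof.
case: n X => [|n] X.
  have no l : ~ is_eigenvalue X l by move=> /negP; apply; rewrite thinmx0.
  split=> [_ l /no //|_]; rewrite /spectral_radius.
  rewrite (_ : mkset _ = classical_sets.set0) ?sup0 //.
  by apply/seteqP; split=> r // -[l /no].
have [[m em <-] maxm] := spectral_radius_max X (ltn0Sn n).
split=> [m0 l el|e0]; last by rewrite (e0 m em) Normc.normc0.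
apply: Normc.eq0_normc; apply/le_anti/andP; split; first by rewrite -[leRHS]m0 maxm.
by case: (l) => a b; exact: sqrtr_ge0.
Qed.

(** The characteristic polynomial splits over the complex numbers with all its
    roots equal to 0, so it is ['X^n] and Cayley-Hamilton applies. *)
Lemma spectral_radius_eq0_nilpotent (R : realType) (n : nat) (X : 'M[R]_n.+1) :
  spectral_radius X = 0 -> X ^+ n.+1 = 0.
Proof.
move=> /spectral_radius_eq0 X0; apply: (@map_mx_inj _ _ (real_complex R)).
rewrite raddf0 rmorphXn /=; set Y := map_mx _ _.
have [s def_p] := closed_field_poly_normal (char_poly Y).
move: def_p; rewrite (monicP (char_poly_monic Y)) scale1r => def_p.
have s0 z : z \in s -> z = 0.
  move=> sz; apply: X0.
  by rewrite /is_eigenvalue eigenvalue_root_char def_p root_prod_XsubC.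
have size_s : size s = n.+1.
  by have := size_char_poly Y; rewrite def_p size_prod_XsubC => -[].
have pX : char_poly Y = 'X^(n.+1).
  rewrite def_p (eq_big_seq (fun=> 'X)); last by move=> z /s0 ->; rewrite subr0.
  by rewrite big_const_seq count_predT size_s -Monoid.iteropE.
by have := Cayley_Hamilton Y; rewrite pX rmorphXn /= horner_mx_X.
Qed.

(** Nonnegativity prevents cancellations, so positivity propagates along closed
    walks and contradicts nilpotency.  Row vectors fit the transposed
    convention for edges: entry [i] of [v *m X] collects the [v j] over the
    successors [j] of [i]. *)
Lemma spectral_radius_eq0_acyclic (R : realType) (n : nat) (X : 'M[R]_n) :
  (forall i j, 0 <= X i j) ->
  spectral_radius X = 0 <-> acyclic (graph_of X).
Proof.
move=> X0; split=> [rho0|/acyclicP sink].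
  apply/acyclicP => S /set0Pn[x Sx]; apply: contrapT => nosink.
  case: n X X0 rho0 S x Sx nosink => [|n] X X0 rho0 S x Sx nosink.
    by case: x Sx.
  have succ i : i \in S -> exists2 j, j \in S & 0 < X j i.
    move=> Si; apply: contrapT => nj; apply: nosink; exists i => // j Sj.
    by rewrite inE; apply/negP => Xji; apply: nj; exists j.
  pose v k : 'rV[R]_n.+1 := const_mx 1 *m X ^+ k.
  have vP k : (forall i, 0 <= v k 0 i) /\ (forall i, i \in S -> 0 < v k 0 i).
    elim: k => [|k [v_ge0 v_gt0]].
      by rewrite /v expr0 mulmx1; split=> i; rewrite mxE ?ler01 ?ltr01.
    have vS : v k.+1 = v k *m X by rewrite /v exprSr mulmxA.
    have t_ge0 i j : 0 <= v k 0 j * X j i by exact: mulr_ge0.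
    split=> i; rewrite vS mxE; first exact: sumr_ge0.
    move=> /succ[j Sj Xji]; rewrite (bigD1 j) //=.
    by apply: ltr_pwDl; [exact: mulr_gt0 (v_gt0 j Sj) Xji|exact: sumr_ge0].
  have := (vP n.+1).2 x Sx.
  by rewrite /v spectral_radius_eq0_nilpotent // mulmx0 mxE ltxx.
apply/spectral_radius_eq0 => l /eigenvalueP[v vX v0].
apply/eqP; apply: contraT => l0.
have [|i] := sink [set i | v 0 i != 0].
  apply: contraNneq v0 => S0; apply/eqP/rowP => i; rewrite mxE.
  by apply/eqP; move/setP/(_ i): S0; rewrite !inE => /negbFE.
(* No successor of [i] lies in the support of [v], so all terms
   [v j * X j i] vanish although their sum is [l * v i != 0]. *)
rewrite inE => vi0 noj; move/rowP/(_ i): vX; rewrite !mxE big1 => [|j _].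
  by move/esym/eqP; rewrite mulf_eq0 (negPf l0) (negPf vi0).
have [->|vj0] := eqVneq (v 0 j) 0; first by rewrite mul0r.
have := noj j; rewrite !inE vj0 => /(_ isT) /=.
rewrite lt_neqAle X0 andbT negbK => /eqP Xji.
by rewrite mxE -Xji rmorph0 mulr0.
Qed.

Lemma graph_of_adjmx (R : realType) (n : nat) (H : digraph n) :
  graph_of (adjmx R H) = H.
Proof.
apply/setP => -[i j]; rewrite inE mxE /=.
by case: ifP => _; rewrite ?ltr01 ?ltxx.
Qed.

Lemma adjmx_feasible (R : realType) (n : nat) (H : digraph n) :
  acyclic H -> P_feasible (adjmx R H).
Proof.
have H0 i j : 0 <= adjmx R H i j by rewrite mxE; case: ifP; rewrite ?ler01.
by move=> acH; split=> //; apply/spectral_radius_eq0_acyclic; rewrite ?graph_of_adjmx.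
Qed.

Lemma frobenius_sqr (R : realType) (n : nat) (Z : 'M[R]_n) :
  frobenius Z ^+ 2 = \sum_(e : 'I_n * 'I_n) Z e.2 e.1 ^+ 2.
Proof.
rewrite sqr_sqrtr; last by do 2!apply: sumr_ge0 => ? _; exact: sqr_ge0.
rewrite exchange_big pair_big /=; apply: eq_bigr => e _.
by rewrite real_normK ?num_real.
Qed.

Lemma ler_frobenius (R : realType) (n : nat) (Y Z : 'M[R]_n) :
  (frobenius Y <= frobenius Z) = (frobenius Y ^+ 2 <= frobenius Z ^+ 2).
Proof. by rewrite ler_sqr ?nnegrE ?sqrtr_ge0. Qed.

(** A missing edge contributes [(0 - 1) ^+ 2 = 1]; any other entry contributes a
    square, which vanishes only when [X] agrees there with [G]. The inequality
    and its equality case hold entrywise, hence for the sums. *)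
Lemma leif_frobenius_sub_adjmx (R : realType) (n : nat) (G : digraph n)
    (X : 'M[R]_n) : (forall i j, 0 <= X i j) ->
  #|G :\: graph_of X|%:R <= frobenius (X - adjmx R G) ^+ 2
    ?= iff (X == adjmx R (G :&: graph_of X)).
Proof.
move=> X0; rewrite frobenius_sqr -sum1_card natr_sum big_mkcond /=.
(* The trivial condition [true] gives the equality case the shape in which
   [leif_sum] expects it. *)
have -> : (X == adjmx R (G :&: graph_of X)) =
    [forall (e : 'I_n * 'I_n | true), X e.2 e.1 == adjmx R (G :&: graph_of X) e.2 e.1].
  apply/eqP/forallP => [eX e|eX]; first by rewrite -eX eqxx.
  apply/matrixP => j i.
  exact/eqP/(eX (i, j)).
apply: leif_sum => e _; rewrite !mxE -surjective_pairing !inE.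
have [Ge|Ge] := boolP (e \in G); have := X0 e.2 e.1; rewrite le_eqVlt.
- case/predU1P => [<-|Xe]; last rewrite Xe.
    by rewrite ltxx andbF andbT sub0r sqrrN expr1n eqxx; exact/leif_refl.
  by rewrite andbT -subr_eq0 -sqrf_eq0 eq_sym; split; rewrite ?sqr_ge0.
- by rewrite andbF subr0 -sqrf_eq0 eq_sym => _; split; rewrite ?sqr_ge0.
Qed.

Lemma frobenius_adjmx_sub (R : realType) (n : nat) (G H : digraph n) :
  H \subset G ->
  frobenius (adjmx R H - adjmx R G) ^+ 2 = #|G :\: H|%:R.
Proof.
move=> /setIidPr HG; have H0 i j : 0 <= adjmx R H i j.
  by rewrite mxE; case: ifP; rewrite ?ler01.
have [_] := leif_frobenius_sub_adjmx G H0.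
by rewrite graph_of_adjmx HG eqxx => /eqP.
Qed.

Lemma leq_card_setD (T : finType) (G H K : {set T}) :
  (#|G :\: H| <= #|G :\: K|)%N = (#|G :&: K| <= #|G :&: H|)%N.
Proof. by rewrite !cardsD leq_sub2lE // subset_leq_card ?subsetIl. Qed.

Theorem proposition1 (R : realType) (n : nat) (G : digraph n) :
  (forall H : digraph n, solves_MAS G H -> solves_P (adjmx R G) (adjmx R H)) /\
  (forall X : 'M[R]_n, solves_P (adjmx R G) X ->
     boolean_mx X /\ solves_MAS G (graph_of X)).
Proof.
split=> [H [HG acH maxH]|X [[X0 rhoX] minX]].
  split=> [|Y [Y0 rhoY]]; first exact: adjmx_feasible.
  rewrite ler_frobenius frobenius_adjmx_sub //.
  apply: le_trans (leif_frobenius_sub_adjmx G Y0).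
  rewrite ler_nat leq_card_setD (setIidPr HG).
  apply: maxH; first exact: subsetIl.
  apply: acyclicS (subsetIr _ _) _.
  exact/spectral_radius_eq0_acyclic.
(* [adjmx R K] is feasible and attains the lower bound on the distance from
   [X], so the minimality of [X] forces equality in that bound. *)
set K := G :&: graph_of X.
have acX : acyclic (graph_of X) by exact/spectral_radius_eq0_acyclic.
have KG : K \subset G := subsetIl _ _.
have acK : acyclic K := acyclicS (subsetIr _ _) acX.
have lbX := leif_frobenius_sub_adjmx G X0.
have defX : X = adjmx R K.
  apply/eqP; rewrite -(ge_leif lbX) -/K.
  have := minX _ (adjmx_feasible R acK).
  by rewrite ler_frobenius frobenius_adjmx_sub // setDIr setDv set0U.
have gX : graph_of X = K by rewrite [in LHS]defX graph_of_adjmx.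
split=> [i j|]; first by rewrite defX mxE; case: ifP; [right|left].
rewrite gX; split=> // L LG acL.
have := minX _ (adjmx_feasible R acL).
rewrite ler_frobenius {1}defX !frobenius_adjmx_sub // ler_nat leq_card_setD.
by rewrite (setIidPr LG) (setIidPr KG).
Qed.
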